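(* Let $$\begin{array}{ccccccccc}1&\to& N'&\to& G'&\xrightarrow{\pi'}& Q'&\to& 1\\ &&\downarrow{\scriptstyle\alpha_0}&&\downarrow{\scriptstyle\alpha}&&\downarrow{\scriptstyle\overline\alpha}&&\\ 1&\to& N&\to& G&\xrightarrow{\pi}& Q&\to& 1\end{array}$$ be a morphism of group extensions (commutative diagram with exact rows), and let $M$ be a $G$-module, viewed also as a $G'$-module via $\alpha$. Let $j:M^N\hookrightarrow M^{N'}$ be the inclusion. Then the maps $\mathrm{tr}$ and $\rho$ associated with the two extensions are natural, i.e. both of the following hold: (i) $\mathrm{tr}(\alpha_0^*[d]) = j_*\big(\overline\alpha^*(\mathrm{tr}[d])\big)$ in $H^2(Q',M^{N'})$ for all $[d]\in H^1(N,M)^Q$, where $\alpha_0^*[d]=[d\circ\alpha_0]\in H^1(N',M)^{Q'}$, $\overline\alpha^*:H^2(Q,M^N)\to H^2(Q',M^N)$ and $j_*:H^2(Q',M^N)\to H^2(Q',M^{N'})$ are the induced maps; (ii) for all $[\underline e]\in H^2(G,M)_1$, $\rho(\alpha^*[\underline e])$ is the image of $\rho[\underline e]$ under the map $H^1(Q,H^1(N,M))\to H^1(Q',H^1(N',M))$, $[D]\mapsto[\alpha_0^*\circ D\circ\overline\alpha]$, where $\alpha^*:H^2(G,M)_1\to H^2(G',M)_1$ is the induced map.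
   Context: For an extension $1\to N\to G\xrightarrow{\pi}Q\to1$ ($N$ regarded as a normal subgroup of $G$) and a $G$-module $M$ (written additively, action $g\cdot m$): $M\rtimes G$ has law $(m,g)(m',g')=(m+g\cdot m',gg')$. $H^1(N,M)=\mathrm{Der}(N,M)/\mathrm{Inn}(N,M)$, with $Q$-module structure induced by $({}^gd)(n)=g\cdot d(g^{-1}ng)$. $H^2(G,M)$ is the group of equivalence classes of extensions $0\to M\to E\to G\to1$ inducing the given action, and $H^2(G,M)_1=\ker(\mathrm{res}:H^2(G,M)\to H^2(N,M))$. Definition of $\mathrm{tr}:H^1(N,M)^Q\to H^2(Q,M^N)$. For a derivation $d:N\to M$ with $[d]\in H^1(N,M)^Q$, put $H=\{(d(n),n)\mid n\in N\}\le M\rtimes G$. Then $\mathrm{tr}[d]$ is the class of the extension $0\to M^N\to N_{M\rtimes G}(H)/H\to Q\to 1$, where the first map is induced by $m\mapsto(m,1)$ and the second by $(m,g)\mapsto\pi(g)$. Definition of $\rho:H^2(G,M)_1\to H^1(Q,H^1(N,M))$. Let $\underline e: 0\to M\xrightarrow{i}E\xrightarrow{p}G\to 1$ have class in $H^2(G,M)_1$ and choose a homomorphism $s_0:N\to E$ with $p\circ s_0=\mathrm{id}_N$. For $x\in E$ let $({}^x s_0)(n)=x\,s_0(p(x)^{-1}np(x))\,x^{-1}$ and let $d_x\in\mathrm{Der}(N,M)$ be given by $i(d_x(n))=({}^x s_0)(n)\,s_0(n)^{-1}$. Then $\rho[\underline e]$ is the class of the derivation $q\mapsto[d_x]$, for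 any $x$ with $\pi(p(x))=q$; this class does not depend on the choices. The same definitions apply to the extension $1\to N'\to G'\to Q'\to1$. *)

(* Defs.v *)
From HB Require Import structures.
From mathcomp Require Import all_boot ssralg ring_quotient boolp functions.

Set Implicit Arguments.
Unset Strict Implicit.
Unset Printing Implicit Defensive.

Import GRing.Theory.

Local Open Scope ring_scope.
Local Open Scope group_scope.

Section MorphGroup.
Variables (G H : groupType) (f : {multiplicative G -> H}).

Lemma mmorph1 : f 1 = 1.
Proof. by apply: (mulgI (f 1)); rewrite -gmulfM !mulg1. Qed.

Lemma mmorphV x : f x^-1 = (f x)^-1.
Proof. by apply: (mulgI (f x)); rewrite -gmulfM !mulgV mmorph1. Qed.

Lemma mmorphJ x y : f (x ^ y) = f x ^ f y.
Proof. by rewrite /conjg !gmulfM mmorphV. Qed.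

End MorphGroup.

(* A module is an action packed separately from its carrier, since the same
   abelian group is acted upon through several group morphisms. *)
Record gmod (G : groupType) (M : zmodType) := GMod {
  gact :> G -> M -> M;
  gact1 : forall m, gact 1 m = m;
  gactM : forall g h m, gact (g * h) m = gact g (gact h m);
  gactD : forall g, {morph gact g : m m' / m + m'}
}.

Section GModTheory.
Variables (G : groupType) (M : zmodType) (a : gmod G M).

Lemma gact0 g : a g 0 = 0.
Proof. by apply: (addrI (a g 0)); rewrite -gactD !addr0. Qed.

Lemma gactN g m : a g (- m) = - a g m.
Proof. by apply: (addrI (a g m)); rewrite -gactD !subrr gact0. Qed.

Lemma gactB g m m' : a g (m - m') = a g m - a g m'.
Proof. by rewrite gactD gactN. Qed.

Lemma gactK g m : a g^-1 (a g m) = m.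
Proof. by rewrite -gactM mulVg gact1. Qed.

Lemma gactVK g m : a g (a g^-1 m) = m.
Proof. by rewrite -gactM mulgV gact1. Qed.

End GModTheory.

Section GModPull.
Variables (G' G : groupType) (M : zmodType).
Variables (f : {multiplicative G' -> G}) (a : gmod G M).

Definition gmod_pull : gmod G' M.
Proof.
exists (fun g => a (f g)) => [m|g h m|g m m'].
- by rewrite mmorph1 gact1.
- by rewrite gmulfM gactM.
- exact: gactD.
Defined.

End GModPull.

(* G-linear maps.  A map from a G-module a to a G'-module a' that is compatible
   with a morphism f : G' -> G is a gmod_hom from (gmod_pull f a) to a'. *)
Record gmod_hom (G : groupType) (M M' : zmodType)
    (a : gmod G M) (a' : gmod G M') := GModHom {
  ghom :> M -> M';
  ghomD : {morph ghom : m m' / m + m'};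
  ghomJ : forall g m, ghom (a g m) = a' g (ghom m)
}.

Section GModHomTheory.
Variables (G : groupType) (M M' : zmodType).
Variables (a : gmod G M) (a' : gmod G M') (phi : gmod_hom a a').

Lemma ghom0 : phi 0 = 0.
Proof. by apply: (addrI (phi 0)); rewrite -ghomD !addr0. Qed.

Lemma ghomN m : phi (- m) = - phi m.
Proof. by apply: (addrI (phi m)); rewrite -ghomD !subrr ghom0. Qed.

Lemma ghomB m m' : phi (m - m') = phi m - phi m'.
Proof. by rewrite ghomD ghomN. Qed.

End GModHomTheory.

Section Fixed.
Variables (G : groupType) (M : zmodType) (a : gmod G M).

Definition fixed_pred : pred M := fun m => `[< forall g, a g m = m >].

Record fixed := Fixed { fixed_val :> M; _ : fixed_pred fixed_val }.

HB.instance Definition _ := [isSub for fixed_val].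
HB.instance Definition _ := [Choice of fixed by <:].

Lemma fixed_zmod_closed : zmod_closed fixed_pred.
Proof.
split; first by apply/asboolP => g; rewrite gact0.
move=> m m' /asboolP hm /asboolP hm'; apply/asboolP => g.
by rewrite gactB hm hm'.
Qed.

HB.instance Definition _ :=
  GRing.isZmodClosed.Build M fixed_pred fixed_zmod_closed.
HB.instance Definition _ := [SubChoice_isSubZmodule of fixed by <:].

Lemma fixedP (m : fixed) g : a g (val m) = val m.
Proof. by have /asboolP := valP m. Qed.

Definition mkfixed m (hm : forall g, a g m = m) : fixed :=
  Fixed (asboolT hm).

End Fixed.

Section FixedMap.
Variables (G' G : groupType) (M M' : zmodType).
Variables (f : {multiplicative G' -> G}) (a : gmod G M) (a' : gmod G' M').
Variable phi : gmod_hom (gmod_pull f a) a'.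

Lemma fixed_map_subproof (m : fixed a) g : a' g (phi (val m)) = phi (val m).
Proof. by rewrite -ghomJ /= fixedP. Qed.

Definition fixed_map (m : fixed a) : fixed a' :=
  mkfixed (fixed_map_subproof m).

End FixedMap.

Section H1.
Variables (G : groupType) (M : zmodType) (a : gmod G M).

Definition derivation (d : G -> M) :=
  forall g h, d (g * h) = d g + a g (d h).

Definition der_pred : pred (G -> M) := fun d => `[< derivation d >].

Record der := Der { der_fun :> G -> M; _ : der_pred der_fun }.

HB.instance Definition _ := [isSub for der_fun].
HB.instance Definition _ := [Choice of der by <:].

Lemma der_zmod_closed : zmod_closed der_pred.
Proof.
split; first by apply/asboolP => g h; rewrite /= gact0 addr0.
move=> d d' /asboolP hd /asboolP hd'; apply/asboolP => g h.
by rewrite !fctE hd hd' gactB opprD addrACA.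
Qed.

HB.instance Definition _ :=
  GRing.isZmodClosed.Build (G -> M) der_pred der_zmod_closed.
HB.instance Definition _ := [SubChoice_isSubZmodule of der by <:].

Lemma derM (d : der) g h : d (g * h) = d g + a g (d h).
Proof. by have /asboolP := valP d; apply. Qed.

Lemma derDE (d d' : der) g : (d + d') g = d g + d' g.
Proof. by []. Qed.

Lemma derBE (d d' : der) g : (d - d') g = d g - d' g.
Proof. by []. Qed.

Lemma der1 (d : der) : d 1 = 0.
Proof.
apply: (addrI (d 1)).
by rewrite -[X in _ + X](gact1 a) -derM mulg1 addr0.
Qed.

Lemma derV (d : der) g : a g (d g^-1) = - d g.
Proof. by apply: (addrI (d g)); rewrite -derM mulgV der1 subrr. Qed.

Lemma derP (d d' : der) : d =1 d' -> d = d'.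
Proof. by move=> dd'; apply/val_inj/funext. Qed.

Definition mkder d (hd : derivation d) : der := Der (asboolT hd).

Definition inner (d : der) := exists m, forall g, d g = a g m - m.
Definition inner_pred : {pred der} := fun d => `[< inner d >].

Lemma inner_zmod_closed : zmod_closed inner_pred.
Proof.
split; first by apply/asboolP; exists 0 => g; rewrite gact0 subr0.
move=> d d' /asboolP[m hm] /asboolP[m' hm']; apply/asboolP.
by exists (m - m') => g; rewrite derBE hm hm' gactB !opprD addrACA.
Qed.

HB.instance Definition _ :=
  GRing.isZmodClosed.Build der inner_pred inner_zmod_closed.

Definition H1 : zmodType := @Quotient.quot der inner_pred.

Definition H1cls (d : der) : H1 := (\pi_(@Quotient.quot der inner_pred) d)%qT.
Definition H1repr (c : H1) : der := repr (c : @Quotient.quot der inner_pred).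

Lemma H1reprK c : H1cls (H1repr c) = c.
Proof. exact: reprK. Qed.

Lemma H1clsP d d' : H1cls d = H1cls d' <-> inner (d - d').
Proof.
split=> [/eqP|dd'].
  by rewrite /H1cls -Quotient.idealrBE => /asboolP.
by apply/eqP; rewrite /H1cls -Quotient.idealrBE; apply/asboolP.
Qed.

Lemma H1clsD d d' : H1cls (d + d') = H1cls d + H1cls d'.
Proof. exact: (raddfD (\pi_(@Quotient.quot der inner_pred))%qT). Qed.

Lemma H1clsB d d' : H1cls (d - d') = H1cls d - H1cls d'.
Proof. exact: (raddfB (\pi_(@Quotient.quot der inner_pred))%qT). Qed.

Lemma H1cls0 : H1cls 0 = 0.
Proof. exact: (raddf0 (\pi_(@Quotient.quot der inner_pred))%qT). Qed.

End H1.

Section H1Map.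
Variables (G' G : groupType) (M M' : zmodType).
Variables (f : {multiplicative G' -> G}) (a : gmod G M) (a' : gmod G' M').
Variable phi : gmod_hom (gmod_pull f a) a'.

Lemma der_map_subproof (d : der a) : derivation a' (fun g => phi (d (f g))).
Proof. by move=> g h; rewrite gmulfM derM ghomD ghomJ. Qed.

Definition der_map (d : der a) : der a' := mkder (der_map_subproof d).

Definition H1map (c : H1 a) : H1 a' := H1cls (der_map (H1repr c)).

Lemma H1map_cls d : H1map (H1cls d) = H1cls (der_map d).
Proof.
apply/H1clsP; have /H1clsP[m hm] := H1reprK (H1cls d).
exists (phi m) => g; rewrite derBE /= -ghomB -derBE hm.
by rewrite ghomB -ghomJ.
Qed.

Lemma H1mapD : {morph H1map : c c' / c + c'}.
Proof.
move=> c c'; rewrite -[c]H1reprK -[c']H1reprK -H1clsD !H1map_cls -H1clsD.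
by congr H1cls; apply: derP => g; rewrite derDE /= ghomD.
Qed.

End H1Map.

Record gext (N G Q : groupType) := GExt {
  inc : {multiplicative N -> G};
  prj : {multiplicative G -> Q};
  inc_inj : injective inc;
  prj_surj : forall q, exists g, prj g = q;
  gext_exact : forall g, prj g = 1 <-> exists n, inc n = g
}.

Arguments inc {N G Q} e : rename.
Arguments prj {N G Q} e : rename.
Arguments inc_inj {N G Q} e [x1 x2] : rename.
Arguments prj_surj {N G Q} e q : rename.
Arguments gext_exact {N G Q} e g : rename.

Section GExtTheory.
Variables (N G Q : groupType) (e : gext N G Q).

Definition lift (q : Q) : G := sval (cid (prj_surj e q)).

Lemma liftK q : prj e (lift q) = q.
Proof. exact: svalP (cid (prj_surj e q)). Qed.

Lemma prj_inc n : prj e (inc e n) = 1.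
Proof. by apply/gext_exact; exists n. Qed.

Lemma kconj_subproof n g : exists k, inc e k = inc e n ^ g.
Proof. by apply/gext_exact; rewrite mmorphJ prj_inc conj1g. Qed.

(* The element g^-1 n g, where N is identified with its image in G. *)
Definition kconj n g : N := sval (cid (kconj_subproof n g)).

Lemma inc_kconj n g : inc e (kconj n g) = inc e n ^ g.
Proof. exact: svalP (cid (kconj_subproof n g)). Qed.

Lemma kconjM n n' g : kconj (n * n') g = kconj n g * kconj n' g.
Proof.
by apply: (inc_inj e); rewrite gmulfM !inc_kconj gmulfM conjMg.
Qed.

Lemma kconj1 n : kconj n 1 = n.
Proof. by apply: (inc_inj e); rewrite inc_kconj conjg1. Qed.

Lemma kconjJ n g h : kconj n (g * h) = kconj (kconj n g) h.
Proof. by apply: (inc_inj e); rewrite !inc_kconj conjgM. Qed.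

Lemma kconj_inc n k : kconj n (inc e k) = n ^ k.
Proof. by apply: (inc_inj e); rewrite inc_kconj mmorphJ. Qed.

Lemma prj_eq g g' : prj e g = prj e g' -> exists n, g' = g * inc e n.
Proof.
move=> h; have /gext_exact[n hn] : prj e (g^-1 * g') = 1.
  by rewrite gmulfM mmorphV h mulVg.
by exists n; rewrite hn mulVKg.
Qed.

End GExtTheory.

Section QActions.
Variables (N G Q : groupType) (e : gext N G Q) (M : zmodType) (a : gmod G M).

Definition resN : gmod N M := gmod_pull (inc e) a.

Lemma fixed_actP (m : fixed resN) g n : resN n (a g (val m)) = a g (val m).
Proof.
rewrite /= -gactM conjgC -inc_kconj gactM.
by congr (a g _); apply: (fixedP m).
Qed.

Definition fixed_act g (m : fixed resN) : fixed resN :=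
  mkfixed (fixed_actP m g).

Lemma fixed_act_prj g g' m :
  prj e g = prj e g' -> fixed_act g m = fixed_act g' m.
Proof.
move=> /prj_eq[n ->]; apply/val_inj; rewrite /= gactM.
by congr (a g _); apply/esym/(fixedP m n).
Qed.

(* q acts as any g above q, see fixedQE. *)
Definition fixedQ : gmod Q (fixed resN).
Proof.
exists (fun q => fixed_act (lift e q)) => [m|q r m|q m m'].
- rewrite (@fixed_act_prj _ 1); last by rewrite liftK mmorph1.
  by apply/val_inj; rewrite /= gact1.
- rewrite (@fixed_act_prj _ (lift e q * lift e r)); last first.
    by rewrite gmulfM !liftK.
  by apply/val_inj; rewrite /= gactM.
- by apply/val_inj; rewrite /= gactD.
Defined.

Lemma fixedQE g m : fixedQ (prj e g) m = fixed_act g m.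
Proof. by apply: fixed_act_prj; rewrite liftK. Qed.

Lemma der_act_subproof g (d : der resN) :
  derivation resN (fun n => a g (d (kconj e n g))).
Proof.
move=> n n'; rewrite kconjM derM gactD /=; congr (_ + _).
by rewrite -!gactM inc_kconj -conjgC.
Qed.

(* The derivation n |-> g . d (g^-1 n g). *)
Definition der_act g (d : der resN) : der resN :=
  mkder (der_act_subproof g d).

Lemma der_act1 d : der_act 1 d = d.
Proof. by apply: derP => n; rewrite /= gact1 kconj1. Qed.

Lemma der_actM g h d : der_act (g * h) d = der_act g (der_act h d).
Proof. by apply: derP => n; rewrite /= gactM kconjJ. Qed.

Lemma der_actD g d d' : der_act g (d + d') = der_act g d + der_act g d'.
Proof. by apply: derP => n; rewrite derDE /= gactD. Qed.

Lemma der_act_cls g d d' :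
  H1cls d = H1cls d' -> H1cls (der_act g d) = H1cls (der_act g d').
Proof.
move=> /H1clsP[m hm]; apply/H1clsP; exists (a g m) => n.
rewrite derBE /= -gactB -derBE hm gactB /= -!gactM inc_kconj.
by rewrite -conjgC.
Qed.

Lemma der_act_inc k d : H1cls (der_act (inc e k) d) = H1cls d.
Proof.
apply/H1clsP; exists (d k) => n; rewrite derBE /= kconj_inc conjgE.
have /= := derM d k (k^-1 * (n * k)); rewrite mulVKg derM /= => E.
rewrite -[a _ (d (_ * _))](addKr (d k)) -E (addrC (d n)) !addrA addrK.
exact: addrC.
Qed.

Lemma der_act_prj g g' d :
  prj e g = prj e g' -> H1cls (der_act g d) = H1cls (der_act g' d).
Proof.
move=> /prj_eq[n ->]; rewrite der_actM; apply: der_act_cls.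
by rewrite der_act_inc.
Qed.

(* q acts as any g above q, on any representative, see H1QE. *)
Definition H1Q : gmod Q (H1 resN).
Proof.
exists (fun q c => H1cls (der_act (lift e q) (H1repr c))) => [c|q r c|q c c'].
- rewrite (@der_act_prj _ 1) ?liftK ?mmorph1 // der_act1; exact: H1reprK.
- rewrite (@der_act_prj _ (lift e q * lift e r)) ?gmulfM ?liftK //.
  rewrite der_actM; apply: der_act_cls; by rewrite H1reprK.
- rewrite -H1clsD -der_actD; apply: der_act_cls.
  by rewrite H1clsD !H1reprK.
Defined.

Lemma H1QE g d : H1Q (prj e g) (H1cls d) = H1cls (der_act g d).
Proof.
rewrite /= (@der_act_prj _ g) ?liftK //; apply: der_act_cls.
exact: H1reprK.
Qed.

End QActions.

Definition mkmult (G H : groupType) (f : G -> H)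
    (fM : {morph f : x y / x * y}) : {multiplicative G -> H} :=
  HB.pack f (isMultiplicative.Build G H f fM).

Record normsub (G : groupType) := NormSub {
  nmem :> G -> Prop;
  nmem1 : nmem 1;
  nmemM : forall x y, nmem x -> nmem y -> nmem (x * y);
  nmemV : forall x, nmem x -> nmem x^-1;
  nmemJ : forall x y, nmem x -> nmem (x ^ y)
}.

Section GroupQuotient.
Variables (G : groupType) (K : normsub G).

Definition coset_rel : rel G := fun x y => `[< K (x^-1 * y) >].

Lemma coset_relP : equiv_class_of coset_rel.
Proof.
split=> [x|x y|y x z].
- by apply/asboolP; rewrite mulVg; apply: nmem1.
- by apply/asboolP/asboolP => /nmemV; rewrite invgM invgK.
- move=> /asboolP hxy /asboolP hyz; apply/asboolP.
  by have := nmemM hxy hyz; rewrite -mulgA mulVKg.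
Qed.

Canonical coset_equiv := EquivRelPack coset_relP.

Definition gquot := {eq_quot coset_rel}%qT.

HB.instance Definition _ := Choice.on gquot.

Definition gcls (x : G) : gquot := (\pi_gquot x)%qT.
Definition grepr (c : gquot) : G := repr c.

Lemma greprK c : gcls (grepr c) = c.
Proof. exact: reprK. Qed.

Lemma gclsP x y : gcls x = gcls y <-> K (x^-1 * y).
Proof. by split=> [/eqmodP/asboolP|h]; last exact/eqmodP/asboolP. Qed.

Definition gquot_mul (c c' : gquot) := gcls (grepr c * grepr c').
Definition gquot_inv (c : gquot) := gcls (grepr c)^-1.

Lemma gquot_mulE x y : gquot_mul (gcls x) (gcls y) = gcls (x * y).
Proof.
have /gclsP hx := esym (greprK (gcls x)).
have /gclsP hy := esym (greprK (gcls y)).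
apply/esym/gclsP; rewrite invgM -!mulgA (mulgA x^-1).
have := nmemM hy (nmemJ (grepr (gcls y)) hx).
by rewrite conjgE -!mulgA !mulVKg !mulgA.
Qed.

Lemma gquot_invE x : gquot_inv (gcls x) = gcls x^-1.
Proof.
have /gclsP hx := esym (greprK (gcls x)).
apply/gclsP; rewrite invgK.
have := nmemJ x^-1 hx.
by rewrite conjgE invgK -!mulgA mulVKg.
Qed.

Lemma gquot_mulA : associative gquot_mul.
Proof.
move=> x y z; rewrite -[x]greprK -[y]greprK -[z]greprK.
by rewrite !gquot_mulE mulgA.
Qed.

Lemma gquot_mul1 : left_id (gcls 1) gquot_mul.
Proof. by move=> x; rewrite -[x]greprK gquot_mulE mul1g. Qed.

Lemma gquot_mulr1 : right_id (gcls 1) gquot_mul.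
Proof. by move=> x; rewrite -[x]greprK gquot_mulE mulg1. Qed.

Lemma gquot_mulV : left_inverse (gcls 1) gquot_inv gquot_mul.
Proof. by move=> x; rewrite -[x]greprK gquot_invE gquot_mulE mulVg. Qed.

Lemma gquot_mulrV : right_inverse (gcls 1) gquot_inv gquot_mul.
Proof. by move=> x; rewrite -[x]greprK gquot_invE gquot_mulE mulgV. Qed.

HB.instance Definition _ := isGroup.Build gquot
  gquot_mulA gquot_mul1 gquot_mulr1 gquot_mulV gquot_mulrV.

Lemma gclsM : {morph gcls : x y / x * y}.
Proof. by move=> x y; rewrite -gquot_mulE. Qed.

Lemma gcls1P x : gcls x = 1 <-> K x.
Proof.
have -> : (1 : gquot) = gcls 1 by [].
split=> [/esym/gclsP|h]; first by rewrite invg1 mul1g.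
by apply/esym/gclsP; rewrite invg1 mul1g.
Qed.

End GroupQuotient.

Section QuotientMap.
Variables (G H : groupType) (K : normsub G) (f : {multiplicative G -> H}).
Hypothesis fK : forall x, K x -> f x = 1.

Lemma gquot_lift_cls x : f (grepr (gcls K x)) = f x.
Proof.
have /gclsP/fK := greprK (gcls K x).
by rewrite gmulfM mmorphV => /mulg1_eq; rewrite invgK.
Qed.

Lemma gquot_lift_subproof : {morph (fun c : gquot K => f (grepr c)) :
  x y / x * y}.
Proof.
move=> x y; rewrite -{1}[x]greprK -{1}[y]greprK -gclsM gquot_lift_cls.
exact: gmulfM.
Qed.

Definition gquot_lift : {multiplicative gquot K -> H} :=
  mkmult gquot_lift_subproof.

Lemma gquot_liftE x : gquot_lift (gcls K x) = f x.
Proof. exact: gquot_lift_cls. Qed.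

End QuotientMap.

Section Normalizer.
Variables (G : groupType) (H : G -> Prop).

Definition normalizer_pred : pred G :=
  fun x => `[< forall y, H (y ^ x) <-> H y >].

Record normalizer :=
  Normalizer { normalizer_val :> G; _ : normalizer_pred normalizer_val }.

HB.instance Definition _ := [isSub for normalizer_val].
HB.instance Definition _ := [Choice of normalizer by <:].

Lemma normalizer_closed : group_closed normalizer_pred.
Proof.
split; first by apply/asboolP => y; rewrite conjg1.
move=> x y /asboolP hx /asboolP hy; apply/asboolP => z.
by rewrite conjgM -hy conjgKV.
Qed.

HB.instance Definition _ :=
  SubChoice_isSubGroup.Build G normalizer_pred normalizer normalizer_closed.

Lemma normalizer_valM : {morph normalizer_val : x y / x * y}.
Proof. by []. Qed.

Lemma normalizer_valV : {morph normalizer_val : x / x^-1}.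
Proof. exact: (@mmorphV normalizer G (mkmult normalizer_valM)). Qed.

Lemma normalizerP (x : normalizer) y : H (y ^ (x : G)) <-> H y.
Proof. by have /asboolP := valP x; apply. Qed.

Definition mknormalizer x (hx : forall y, H (y ^ x) <-> H y) : normalizer :=
  Normalizer (asboolT hx).

End Normalizer.

Section Semidirect.
Variables (G : groupType) (M : zmodType) (a : gmod G M).

Definition sdprod of gmod G M : Type := (M * G)%type.

HB.instance Definition _ := Choice.copy (sdprod a) (M * G)%type.

Definition sd_mul (x y : sdprod a) : sdprod a :=
  ((x.1 + a x.2 y.1)%R, x.2 * y.2).
Definition sd_one : sdprod a := (0%R, 1).
Definition sd_inv (x : sdprod a) : sdprod a := (- a x.2^-1 x.1, x.2^-1).

Lemma sd_mulA : associative sd_mul.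
Proof. by move=> x y z; rewrite /sd_mul /= gactD gactM addrA mulgA. Qed.

Lemma sd_mul1 : left_id sd_one sd_mul.
Proof. by case=> m g; rewrite /sd_mul /= mul1g gact1 add0r. Qed.

Lemma sd_mulr1 : right_id sd_one sd_mul.
Proof. by case=> m g; rewrite /sd_mul /= mulg1 gact0 addr0. Qed.

Lemma sd_mulV : left_inverse sd_one sd_inv sd_mul.
Proof. by case=> m g; rewrite /sd_mul /= mulVg addNr. Qed.

Lemma sd_mulrV : right_inverse sd_one sd_inv sd_mul.
Proof. by case=> m g; rewrite /sd_mul /= mulgV gactN gactVK subrr. Qed.

HB.instance Definition _ := isGroup.Build (sdprod a)
  sd_mulA sd_mul1 sd_mulr1 sd_mulV sd_mulrV.

Lemma sdM (x y : sdprod a) : x * y = ((x.1 + a x.2 y.1)%R, x.2 * y.2).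
Proof. by []. Qed.

Lemma sdV (x : sdprod a) : x^-1 = (- a x.2^-1 x.1, x.2^-1).
Proof. by []. Qed.

Definition sd_inj (m : M) : sdprod a := (m, 1).

Lemma sd_snd_subproof : {morph (fun x : sdprod a => x.2) : x y / x * y}.
Proof. by []. Qed.

Definition sd_snd : {multiplicative sdprod a -> G} := mkmult sd_snd_subproof.

End Semidirect.

(* Extensions 0 -> M -> mtot -> G -> 1 inducing the action a. *)
Record mext (G : groupType) (M : zmodType) (a : gmod G M) := MExt {
  mtot : groupType;
  minj : M -> mtot;
  mprj : {multiplicative mtot -> G};
  minjD : forall m m', minj (m + m') = minj m * minj m';
  minj_inj : injective minj;
  mprj_surj : forall g, exists x, mprj x = g;
  mext_exact : forall x, mprj x = 1 <-> exists m, minj m = x;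
  mext_act : forall x m, x * minj m * x^-1 = minj (a (mprj x) m)
}.

Arguments minj {G M a} e m : rename.
Arguments mprj {G M a} e : rename.
Arguments minj_inj {G M a} e [x1 x2] : rename.
Arguments mprj_surj {G M a} e g : rename.
Arguments mext_exact {G M a} e x : rename.

Section MExtTheory.
Variables (G : groupType) (M : zmodType) (a : gmod G M).
Implicit Types e : mext a.

Lemma minj0 e : minj e 0 = 1.
Proof. by apply: (mulgI (minj e 0)); rewrite -minjD addr0 mulg1. Qed.

Lemma minjN e m : minj e (- m) = (minj e m)^-1.
Proof. by apply: (mulgI (minj e m)); rewrite -minjD subrr mulgV minj0. Qed.

Lemma mprj_inj e m : mprj e (minj e m) = 1.
Proof. by apply/mext_exact; exists m. Qed.

Lemma minjC e x m : x * minj e m = minj e (a (mprj e x) m) * x.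
Proof. by rewrite -mext_act mulgVK. Qed.

Lemma mprj_eq e x y : mprj e x = mprj e y -> exists m, y = minj e m * x.
Proof.
move=> h; have /mext_exact[m hm] : mprj e (y * x^-1) = 1.
  by rewrite gmulfM mmorphV h mulgV.
by exists m; rewrite hm mulgVK.
Qed.

Definition mequiv e e' := exists phi : {multiplicative mtot e -> mtot e'},
  (forall m, phi (minj e m) = minj e' m) /\
  (forall x, mprj e' (phi x) = mprj e x).

Lemma mequiv_refl e : mequiv e e.
Proof. by exists (@idfun (mtot e) : {multiplicative _ -> _}). Qed.

Lemma mequiv_trans e1 e2 e3 : mequiv e1 e2 -> mequiv e2 e3 -> mequiv e1 e3.
Proof.
move=> [f [fi fp]] [g [gi gp]].
exists (g \o f : {multiplicative _ -> _}); split=> [m|x] /=.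
  by rewrite fi gi.
by rewrite gp fp.
Qed.

Lemma mequiv_sym e e' : mequiv e e' -> mequiv e' e.
Proof.
move=> [f [fi fp]].
have finj : injective f.
  move=> x y fxy; have [m ym] : exists m, y = minj e m * x.
    by apply: mprj_eq; rewrite -!fp fxy.
  move: fxy; rewrite ym gmulfM fi -{1}[f x]mul1g => /mulIg.
  by rewrite -(minj0 e') => /(minj_inj e') <-; rewrite minj0 mul1g.
have fsurj y : exists x, f x = y.
  have [x xy] := mprj_surj e (mprj e' y).
  have [m ->] : exists m, y = minj e' m * f x.
    by apply: mprj_eq; rewrite fp xy.
  by exists (minj e m * x); rewrite gmulfM fi.
pose g y := sval (cid (fsurj y)).
have gK y : f (g y) = y := svalP (cid (fsurj y)).
have gM : {morph g : x y / x * y}.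
  by move=> x y; apply: finj; rewrite gmulfM !gK.
exists (mkmult gM); split=> [m|x] /=.
  by apply: finj; rewrite gK fi.
by rewrite -fp gK.
Qed.

(* H^2(G, M) as a set of equivalence classes.  Only its zero, the class of the
   split extension mext_split, is needed below, to define H2ker. *)
Record H2 := MkH2 {
  H2mem :> mext a -> Prop;
  H2memP : exists e, H2mem = mequiv e
}.

Lemma H2_cls_subproof e : exists e', mequiv e = mequiv e'.
Proof. by exists e. Qed.

Definition H2cls e : H2 := MkH2 (H2_cls_subproof e).
Definition H2repr (c : H2) : mext a := sval (cid (H2memP c)).

Lemma H2reprK c : H2cls (H2repr c) = c.
Proof.
case: c => C hC; rewrite /H2repr /H2cls /=.
case: (cid _) => e /= he; move: hC (H2_cls_subproof e); rewrite he => p q.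
by congr MkH2; apply: Prop_irrelevance.
Qed.

Lemma H2clsP e e' : H2cls e = H2cls e' <-> mequiv e e'.
Proof.
split=> [[h]|h].
  by rewrite h; apply: mequiv_refl.
rewrite /H2cls; move: (H2_cls_subproof e) (H2_cls_subproof e').
suff -> : mequiv e = mequiv e'.
  by move=> p q; congr MkH2; apply: Prop_irrelevance.
apply/funext => x; apply/propext; split; apply: mequiv_trans => //.
exact: mequiv_sym.
Qed.

Lemma mext_split_subproof x : sd_snd a x = 1 <-> exists m, sd_inj a m = x.
Proof.
split=> [|[m <-]//]; case: x => m g /= ->; by exists m.
Qed.

Definition mext_split : mext a.
Proof.
exists (sdprod a) (@sd_inj G M a) (sd_snd a) => [m m'|m m' []|g|x|x m] //.
- by rewrite sdM /= gact1 mulg1.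
- by exists (0%R, g).
- exact: mext_split_subproof.
- rewrite !sdM sdV /= mulg1 mulgV gactN gactVK.
  by rewrite addrAC subrr add0r.
Defined.

End MExtTheory.

(* The pullback of an extension of G along f : G' -> G is the fibre product of
   the two groups over G. *)
Section Pullback.
Variables (G' G : groupType) (M : zmodType).
Variables (f : {multiplicative G' -> G}) (a : gmod G M).

Section Ext.
Variable e : mext a.

Definition fib_pred : pred (mtot e * G')%type :=
  fun x => mprj e x.1 == f x.2.

Record fib := Fib { fib_val :> (mtot e * G')%type; _ : fib_pred fib_val }.

HB.instance Definition _ := [isSub for fib_val].
HB.instance Definition _ := [Choice of fib by <:].

Lemma fib_closed : group_closed fib_pred.
Proof.
split; first by apply/eqP; rewrite !mmorph1.
move=> x y /eqP hx /eqP hy; apply/eqP.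
by rewrite /= !gmulfM !mmorphV hx hy.
Qed.

HB.instance Definition _ :=
  SubChoice_isSubGroup.Build _ fib_pred fib fib_closed.

Definition mkfib x g (h : mprj e x = f g) : fib := @Fib (x, g) (introT eqP h).

Lemma fibP (x : fib) : mprj e (val x).1 = f (val x).2.
Proof. exact/eqP/(valP x). Qed.

Lemma fib_inj_subproof m : mprj e (minj e m) = f 1.
Proof. by rewrite mprj_inj mmorph1. Qed.

Definition fib_inj m : fib := mkfib (fib_inj_subproof m).

Lemma fib_prj_subproof : {morph (fun x : fib => (val x).2) : x y / x * y}.
Proof. by []. Qed.

Definition fib_prj : {multiplicative fib -> G'} := mkmult fib_prj_subproof.

Definition mext_pull : mext (gmod_pull f a).
Proof.
exists fib fib_inj fib_prj => [m m'|m m' [] /(minj_inj e)//|g|x|x m].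
- by apply/val_inj; congr (_, _); rewrite /= ?minjD // mulg1.
- have [x hx] := mprj_surj e (f g); by exists (mkfib hx).
- split=> [x1|[m <-]//]; have := fibP x; rewrite [X in f X]x1 mmorph1.
  move=> /(mext_exact e)[m hm]; exists m; apply/val_inj.
  by rewrite [val x]surjective_pairing -hm [(val x).2]x1.
- apply/val_inj; congr (_, _); last by rewrite /= mulg1 mulgV.
  by rewrite /= mext_act [mprj e _](fibP x).
Defined.

End Ext.

Lemma mext_pull_equiv e e' : mequiv e e' -> mequiv (mext_pull e) (mext_pull e').
Proof.
move=> [phi [phii phip]].
have h (x : fib e) : mprj e' (phi (val x).1) = f (val x).2.
  by rewrite phip fibP.
pose psi (x : fib e) : fib e' := mkfib (h x).
have psiM : {morph psi : x y / x * y}.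
  by move=> x y; apply/val_inj; congr (_, _); rewrite /= gmulfM.
exists (mkmult psiM : {multiplicative mtot (mext_pull e) -> _}).
by split=> [m|//]; apply/val_inj; congr (_, _); apply: phii.
Qed.

Definition H2pull (c : H2 a) : H2 (gmod_pull f a) :=
  H2cls (mext_pull (H2repr c)).

Lemma H2pull_cls e : H2pull (H2cls e) = H2cls (mext_pull e).
Proof.
by apply/H2clsP/mext_pull_equiv/H2clsP; rewrite H2reprK.
Qed.

Lemma H2pull_splitP e :
  H2pull (H2cls e) = H2cls (mext_split (gmod_pull f a)) <->
  exists s : {multiplicative G' -> mtot e}, forall g, mprj e (s g) = f g.
Proof.
rewrite H2pull_cls H2clsP; split=> [/mequiv_sym[phi [phii phip]]|[s sp]].
  have sM : {morph (fun g => (val (phi (0%R, g))).1) : g h / g * h}.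
    move=> g h; rewrite -[RHS]/(val (phi (0%R, g) * phi (0%R, h))).1 -gmulfM.
    by rewrite sdM /= gact0 addr0.
  exists (mkmult sM) => g /=.
  by rewrite [LHS](fibP (phi (0%R, g))); congr (f _); apply: (phip (_, g)).
apply: mequiv_sym.
have h (x : sdprod (gmod_pull f a)) : mprj e (minj e x.1 * s x.2) = f x.2.
  by rewrite gmulfM mprj_inj mul1g sp.
pose psi x : fib e := mkfib (h x).
have psiM : {morph psi : x y / x * y}.
  move=> x y; apply/val_inj; congr (_, _).
  rewrite /= gmulfM minjD -!mulgA; congr (_ * _).
  by rewrite !mulgA minjC sp.
exists (mkmult psiM : {multiplicative mtot (mext_split _) -> _}).
by split=> [m|//]; apply/val_inj; congr (_, _); rewrite /= mmorph1 mulg1.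
Qed.

End Pullback.

(* The pushout of an extension E by M along phi : M -> M' is the quotient of the
   semidirect product of M' and E by the elements (- phi m, m) for m in M. *)
Section Pushout.
Variables (G : groupType) (M M' : zmodType).
Variables (a : gmod G M) (a' : gmod G M') (phi : gmod_hom a a').

Section Ext.
Variable e : mext a.

Let T := sdprod (gmod_pull (mprj e) a').

Definition push_rel_mem (x : T) := exists m, x = (- phi m, minj e m).

Definition push_rel : normsub T.
Proof.
exists push_rel_mem.
- by exists 0%R; rewrite ghom0 oppr0 minj0.
- move=> _ _ [m ->] [m' ->]; exists (m + m'); rewrite sdM /= mprj_inj gact1.
  by rewrite ghomD opprD minjD.
- move=> _ [m ->]; exists (- m); rewrite sdV /= -minjN mprj_inj gact1.
  by rewrite ghomN.
- move=> _ y [m ->]; exists (a (mprj e y.2^-1) m).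
  rewrite -mext_act invgK conjgE !sdM sdV /= mprj_inj gact1 ghomJ.
  rewrite mulgA; congr (_, _).
  by rewrite gactD addrCA addNr addr0 gactN.
Defined.

Definition push_inj (m : M') : gquot push_rel := gcls push_rel (m, 1).

Lemma push_prj_subproof :
  {morph (fun x : T => mprj e x.2) : x y / x * y}.
Proof. by move=> x y; rewrite /= gmulfM. Qed.

Lemma push_prj_kernel x : push_rel x -> mkmult push_prj_subproof x = 1.
Proof. by move=> [m ->]; rewrite /= mprj_inj. Qed.

Definition push_prj : {multiplicative gquot push_rel -> G} :=
  gquot_lift push_prj_kernel.

Lemma push_prjE x : push_prj (gcls push_rel x) = mprj e x.2.
Proof. exact: gquot_liftE. Qed.

Definition mext_push : mext a'.
Proof.
exists (gquot push_rel) push_inj push_prj => [m m'|m m'|g|x|x m].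
- by rewrite -gclsM sdM /= mmorph1 gact1 mulg1.
- move=> /gclsP[k]; rewrite sdM sdV /= !invg1 mul1g mmorph1 !gact1 => -[E K1].
  move: E; have -> : k = 0%R by apply: (minj_inj e); rewrite minj0.
  by rewrite ghom0 oppr0 => /eqP; rewrite addrC subr_eq0 => /eqP.
- have [x <-] := mprj_surj e g; exists (gcls push_rel (0%R, x)).
  by rewrite push_prjE.
- rewrite -[x]greprK push_prjE; case: (grepr x) => m y /=; split.
    move=> /(mext_exact e)[k <-]; exists (m + phi k).
    apply/gclsP; exists k; rewrite sdM sdV /= invg1 mul1g mmorph1 !gact1.
    by rewrite opprD addrC addrA subrr add0r.
  by move=> [k /(congr1 push_prj)]; rewrite !push_prjE mmorph1 => /esym.
- rewrite -[x]greprK push_prjE /push_inj; case: (grepr x) => k y /=.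
  apply: (canLR (mulgK _)); rewrite -!gclsM; congr gcls.
  by rewrite !sdM /= mmorph1 gact1 mulg1 mul1g addrC.
Defined.

End Ext.

Lemma mext_push_equiv e e' : mequiv e e' -> mequiv (mext_push e) (mext_push e').
Proof.
move=> [psi [psii psip]].
pose T (e0 : mext a) : groupType := sdprod (gmod_pull (mprj e0) a').
have h1M : {morph (fun x : T e => (x.1, psi x.2) : T e') : x y / x * y}.
  by move=> x y; rewrite !sdM /= gmulfM psip.
have h2M : {morph (fun x : T e => gcls (push_rel e') (mkmult h1M x)) :
    x y / x * y}.
  by move=> x y; rewrite gmulfM gclsM.
have h2K x : push_rel e x -> mkmult h2M x = 1.
  by move=> [m ->]; apply/gcls1P; exists m; rewrite /= psii.
exists (gquot_lift h2K : {multiplicative mtot (mext_push e) -> _}).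
split=> [m|x]; first by apply: (etrans (gquot_liftE h2K _)); rewrite /= mmorph1.
rewrite -[x]greprK [X in mprj _ X](gquot_liftE h2K).
by apply: (etrans (push_prjE _)); rewrite [RHS]push_prjE /= psip.
Qed.

Definition H2push (c : H2 a) : H2 a' := H2cls (mext_push (H2repr c)).

Lemma H2push_cls e : H2push (H2cls e) = H2cls (mext_push e).
Proof.
by apply/H2clsP/mext_push_equiv/H2clsP; rewrite H2reprK.
Qed.

End Pushout.

Section Tr.
Variables (N G Q : groupType) (e : gext N G Q) (M : zmodType) (a : gmod G M).

Section Ext.
Variable d : der (resN e a).
Hypothesis d_inv : forall q, H1Q e a q (H1cls d) = H1cls d.

(* The subgroup {(d n, n) | n in N} of the semidirect product. *)
Definition graph (x : sdprod a) := exists n, x = (d n, inc e n).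

Lemma graphJ m g n :
  ((d (kconj e n g), inc e (kconj e n g)) : sdprod a) ^ ((m, g) : sdprod a)^-1
  = ((m + a g (d (kconj e n g)))%R - a (inc e n) m, inc e n).
Proof.
rewrite conjgE invgK !sdM sdV /=.
have gn : g * (inc e (kconj e n g) * g^-1) = inc e n.
  by rewrite inc_kconj mulgA -conjgC mulgK.
by rewrite gn !gactD !gactN -!gactM -mulgA gn addrA.
Qed.

Lemma graph_normP m g :
  (forall y : sdprod a, graph (y ^ ((m, g) : sdprod a)) <-> graph y) <->
  (forall n, a g (d (kconj e n g)) - d n = a (inc e n) m - m).
Proof.
have E n : (m + a g (d (kconj e n g)))%R - a (inc e n) m = d n <->
    a g (d (kconj e n g)) - d n = a (inc e n) m - m.
  split=> /eqP; rewrite subr_eq => /eqP h; apply/eqP.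
    by rewrite subr_eq addrAC eq_sym subr_eq addrC -h addrC.
  by rewrite h addrA (addrC m) subrK addrAC subrr add0r.
split=> [h n|h y].
  apply/E; have := h (((d (kconj e n g), inc e (kconj e n g)) : sdprod a)
    ^ ((m, g) : sdprod a)^-1).
  rewrite conjgKV => -[+ _] => /(_ _)[]; first by exists (kconj e n g).
  by move=> k; rewrite graphJ => -[-> /(inc_inj e)->].
split=> [[k yk]|[n ->]].
  have kg : kconj e (kconj e k g^-1) g = k by rewrite -kconjJ mulVg kconj1.
  exists (kconj e k g^-1).
  rewrite -[y](conjgK ((m, g) : sdprod a)) yk -{1 2}kg graphJ.
  by congr (_, _); apply/E.
exists (kconj e n g); apply: (canLR (conjgKV _)).
by rewrite graphJ; congr (_, _); apply/esym/E.
Qed.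

Definition tr_sub : normsub (normalizer graph).
Proof.
apply: (@NormSub _ (fun x : normalizer graph => graph (normalizer_val x))).
- by exists 1; rewrite der1 mmorph1.
- move=> x y [n hn] [k hk]; exists (n * k).
  by rewrite normalizer_valM hn hk sdM /= derM gmulfM.
- move=> x [n hn]; exists n^-1.
  rewrite normalizer_valV hn sdV /= mmorphV; congr (_, _).
  by rewrite -gactN; have /= <- := derV d n; rewrite gactK.
- move=> x y hx; rewrite /conjg !normalizer_valM normalizer_valV.
  exact: (normalizerP y (normalizer_val x)).2 hx.
Defined.

Definition trgroup := gquot tr_sub.

Lemma tr_inj_subproof (m : fixed (resN e a)) (y : sdprod a) :
  graph (y ^ ((val m, 1) : sdprod a)) <-> graph y.
Proof.
move: y; apply/graph_normP => n.
by rewrite kconj1 gact1 subrr [a _ _](fixedP m n) subrr.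
Qed.

Definition tr_inj (m : fixed (resN e a)) : trgroup :=
  gcls tr_sub (mknormalizer (tr_inj_subproof m)).

Lemma tr_prj_subproof :
  {morph (fun x : normalizer graph => prj e (normalizer_val x).2) :
    x y / x * y}.
Proof. by move=> x y; rewrite normalizer_valM gmulfM. Qed.

Lemma tr_prj_kernel x : tr_sub x -> mkmult tr_prj_subproof x = 1.
Proof. by move=> [n /= ->]; rewrite prj_inc. Qed.

Definition tr_prj : {multiplicative trgroup -> Q} :=
  gquot_lift tr_prj_kernel.

Lemma tr_prjE x : tr_prj (gcls tr_sub x) = prj e (normalizer_val x).2.
Proof. exact: gquot_liftE. Qed.

(* The extension 0 -> M^N -> N(H)/H -> Q -> 1, with H the graph of d. *)
Definition tr_ext : mext (fixedQ e a).
Proof.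
exists trgroup tr_inj tr_prj => [m m'|m m'|q|x|x m].
- rewrite -gclsM; congr gcls; apply/val_inj.
  by rewrite [RHS]normalizer_valM sdM /= gact1 mulg1.
- move=> /gclsP[n hn].
  have : ((val m, 1) : sdprod a)^-1 * ((val m', 1) : sdprod a)
      = (d n, inc e n).
    by rewrite -hn [RHS]normalizer_valM normalizer_valV.
  rewrite sdM sdV /= !invg1 !gact1 mul1g.
  move=> [E n1]; apply/val_inj; move: E.
  have -> : n = 1 by apply: (inc_inj e); rewrite mmorph1.
  by rewrite der1 addrC => /eqP; rewrite subr_eq0 => /eqP.
- have := d_inv q; rewrite -(liftK e q) H1QE => /H1clsP[m hm].
  have hx := (graph_normP m (lift e q)).2 hm.
  by exists (gcls tr_sub (mknormalizer hx)); rewrite tr_prjE.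
- rewrite -[x]greprK tr_prjE; set y := grepr x; split; last first.
    by move=> [m /(congr1 tr_prj)]; rewrite !tr_prjE /= mmorph1 => /esym.
  have := normalizerP y; case yE : (normalizer_val y) => [m g] hy /=.
  move=> /(gext_exact e)[k gk]; move/graph_normP: hy => hy.
  have hm n : resN e a n (m - d k) = m - d k.
    have := hy n; rewrite -gk kconj_inc => E; apply/eqP.
    have /= := derM d k (k^-1 * (n * k)); rewrite mulVKg derM /= => E2.
    move: E; rewrite conjgE -[a _ (d (_ * _))](addKr (d k)) -E2.
    rewrite (addrC (d n)) !addrA addrK gactB /= => /esym E3.
    by rewrite subr_eq -addrA [X in _ == X]addrC -E3 subrK.
  exists (mkfixed hm); apply/gclsP; exists k.
  rewrite [LHS]normalizer_valM normalizer_valV [X in _ * X]yE.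
  rewrite sdM sdV /= invg1 !gact1 mul1g gk.
  by rewrite opprB subrK.
- rewrite -[x]greprK tr_prjE; set y := grepr x.
  apply: (canLR (mulgK _)); rewrite fixedQE /= -!gclsM; congr gcls.
  apply/val_inj; rewrite [LHS]normalizer_valM [RHS]normalizer_valM !sdM /=.
  by rewrite gact1 mulg1 mul1g addrC.
Defined.

End Ext.

Lemma tr_ext_equiv d d' hd hd' :
  H1cls d = H1cls d' -> mequiv (@tr_ext d' hd') (@tr_ext d hd).
Proof.
move=> /H1clsP[b hb].
pose t : sdprod a := (b, 1).
have conjt (x : sdprod a) : x ^ t = ((x.1 + a x.2 b)%R - b, x.2).
  rewrite conjgE !sdM sdV /= !invg1 !gact1 mul1g mulg1.
  by rewrite (addrC (- b)).
have graph_t y : graph d (y ^ t) <-> graph d' y.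
  rewrite conjt; case: y => m g; split=> -[n [/= mE gE]]; exists n.
    rewrite gE; congr (_, _); move: mE; rewrite gE => mE.
    have /eqP := hb n; rewrite derBE -mE subr_eq -addrA addrC.
    by rewrite (inj_eq (addrI _)) => /eqP.
  rewrite mE gE; congr (_, _); have := hb n; rewrite derBE /= => E.
  by rewrite -addrA -E addrC subrK.
have norm_t (x : normalizer (graph d')) (y : sdprod a) :
    graph d (y ^ (normalizer_val x ^ t)) <-> graph d y.
  rewrite -[y](conjgKV t) -conjJg !graph_t; exact: normalizerP.
pose psi x : normalizer (graph d) := mknormalizer (norm_t x).
have psiM : {morph psi : x y / x * y}.
  by move=> x y; apply/val_inj; rewrite [RHS]normalizer_valM /= -conjMg.
have clsM : {morph (fun x => gcls (tr_sub d) (mkmult psiM x)) : x y / x * y}.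
  by move=> x y; rewrite gmulfM gclsM.
have clsK x : tr_sub d' x -> mkmult clsM x = 1.
  by move=> hx; apply/gcls1P; apply/(graph_t (normalizer_val x)).2.
exists (gquot_lift clsK : {multiplicative mtot (tr_ext hd') -> _}).
split=> [m|x].
  apply: (etrans (gquot_liftE clsK _)); congr gcls; apply/val_inj => /=.
  by rewrite conjt /= gact1 addrK.
rewrite -[x]greprK [X in mprj _ X](gquot_liftE clsK).
apply: (etrans (tr_prjE _)); rewrite [RHS]tr_prjE.
exact: (congr1 (fun z : sdprod a => prj e z.2) (conjt _)).
Qed.

Lemma H1repr_fixed (c : fixed (H1Q e a)) q :
  H1Q e a q (H1cls (H1repr (val c))) = H1cls (H1repr (val c)).
Proof. by rewrite H1reprK; apply: fixedP. Qed.

(* Defined from a chosen representative; tr_cls shows that any other one can be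
   used. *)
Definition tr (c : fixed (H1Q e a)) : H2 (fixedQ e a) :=
  H2cls (tr_ext (H1repr_fixed c)).

Lemma tr_cls d (hd : forall q, H1Q e a q (H1cls d) = H1cls d) :
  tr (mkfixed hd) = H2cls (tr_ext hd).
Proof. by apply/H2clsP/tr_ext_equiv; rewrite H1reprK. Qed.

End Tr.

Arguments tr {N G Q} e {M} a c.

Section Rho.
Variables (N G Q : groupType) (e : gext N G Q) (M : zmodType) (a : gmod G M).

Section Ext.
Variables (E : mext a) (s : {multiplicative N -> mtot E}).
Hypothesis sp : forall n, mprj E (s n) = inc e n.

Lemma rho_fun_subproof x n : exists m,
  minj E m = x * s (kconj e n (mprj E x)) * x^-1 * (s n)^-1.
Proof.
apply/mext_exact; rewrite !gmulfM !mmorphV !sp inc_kconj -conjgC.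
by rewrite mulgK mulgV.
Qed.

Definition rho_fun x n : M := sval (cid (rho_fun_subproof x n)).

Lemma rho_funE x n : minj E (rho_fun x n) =
  x * s (kconj e n (mprj E x)) * x^-1 * (s n)^-1.
Proof. exact: svalP (cid (rho_fun_subproof x n)). Qed.

Lemma rho_fun_der x : derivation (resN e a) (rho_fun x).
Proof.
move=> n n'; apply: (minj_inj E); rewrite minjD /= -sp -mext_act !rho_funE.
by rewrite kconjM !gmulfM invgM !mulgA !mulgVK.
Qed.

(* The derivation d_x, such that
   i (d_x n) = x s(p(x)^-1 n p(x)) x^-1 s(n)^-1, see rho_funE. *)
Definition rho_der x : der (resN e a) := mkder (rho_fun_der x).

Lemma rho_derM x y :
  rho_der (x * y) = der_act (mprj E x) (rho_der y) + rho_der x.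
Proof.
apply: derP => n; rewrite derDE /=; apply: (minj_inj E).
rewrite minjD -mext_act !rho_funE gmulfM kconjJ invgM.
by rewrite !mulgA !mulgVK.
Qed.

Lemma rho_der_ker x : prj e (mprj E x) = 1 -> H1cls (rho_der x) = 0.
Proof.
move=> /(gext_exact e)[k hk].
have [m ->] : exists m, x = minj E m * s k.
  by apply: mprj_eq; rewrite sp hk.
rewrite -H1cls0; apply/H1clsP; exists (- m) => n.
rewrite subr0 /=; apply: (minj_inj E).
rewrite rho_funE gmulfM mprj_inj mul1g sp kconj_inc mmorphJ opprK addrC minjD.
by rewrite -sp -mext_act minjN conjgE invgM !mulgA !mulgK.
Qed.

Lemma rho_der_prj x y : prj e (mprj E x) = prj e (mprj E y) ->
  H1cls (rho_der x) = H1cls (rho_der y).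
Proof.
move=> xy; have /rho_der_ker h : prj e (mprj E (x^-1 * y)) = 1.
  by rewrite !gmulfM !mmorphV xy mulVg.
have -> : y = x * (x^-1 * y) by rewrite mulVKg.
by rewrite rho_derM H1clsD -H1QE h gact0 add0r.
Qed.

Lemma prj_mprj_surj q : exists x, prj e (mprj E x) = q.
Proof.
by have [g <-] := prj_surj e q; have [x <-] := mprj_surj E g; exists x.
Qed.

Definition rho_lift q : mtot E := sval (cid (prj_mprj_surj q)).

Lemma rho_liftK q : prj e (mprj E (rho_lift q)) = q.
Proof. exact: svalP (cid (prj_mprj_surj q)). Qed.

Definition rho_cocycle_fun q : H1 (resN e a) := H1cls (rho_der (rho_lift q)).

Lemma rho_cocycle_der : derivation (H1Q e a) rho_cocycle_fun.
Proof.
move=> q r; rewrite /rho_cocycle_fun.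
rewrite (@rho_der_prj _ (rho_lift q * rho_lift r)); last first.
  by rewrite !gmulfM !rho_liftK.
by rewrite rho_derM H1clsD addrC -H1QE rho_liftK.
Qed.

(* The derivation q |-> [d_x], where x is any element of E over q, see
   rho_cocycleE. *)
Definition rho_cocycle : der (H1Q e a) := mkder rho_cocycle_der.

Lemma rho_cocycleE x : rho_cocycle (prj e (mprj E x)) = H1cls (rho_der x).
Proof. by apply: rho_der_prj; rewrite rho_liftK. Qed.

End Ext.

Lemma rho_cocycle_equiv (E E' : mext a) s s' sp sp' : mequiv E E' ->
  H1cls (@rho_cocycle E' s' sp') = H1cls (@rho_cocycle E s sp).
Proof.
move=> [phi [phii phip]].
have bP n : exists m, minj E' m = s' n * (phi (s n))^-1.
  by apply/mext_exact; rewrite gmulfM mmorphV phip sp sp' mulgV.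
pose b n := sval (cid (bP n)).
have bE n : minj E' (b n) = s' n * (phi (s n))^-1 := svalP (cid (bP n)).
have bder : derivation (resN e a) b.
  move=> n n'; apply: (minj_inj E'); rewrite minjD /= -sp -phip -mext_act !bE.
  by rewrite !gmulfM invgM !mulgA mulgVK.
apply/H1clsP; exists (H1cls (mkder bder)) => q; rewrite derBE.
have [x <-] := prj_mprj_surj E q.
rewrite rho_cocycleE -{1}phip rho_cocycleE H1QE.
suff -> : rho_der sp' (phi x) =
    der_act (mprj E x) (mkder bder) + rho_der sp x - mkder bder.
  by rewrite H1clsB H1clsD addrAC addrK.
apply: derP => n; rewrite derBE derDE /=; apply: (minj_inj E').
rewrite !minjD minjN -phip -mext_act !bE -(phii (rho_fun sp x n)) !rho_funE.
rewrite !gmulfM.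
by rewrite !mmorphV invgM invgK !phip !mulgA !mulgVK.
Qed.

(* The kernel of the restriction from H^2(G, M) to H^2(N, M). *)
Definition H2ker :=
  {c : H2 a | H2pull (inc e) c = H2cls (mext_split (resN e a))}.

Lemma rho_section (c : H2ker) :
  exists s : {multiplicative N -> mtot (H2repr (sval c))},
    forall n, mprj _ (s n) = inc e n.
Proof. by apply/H2pull_splitP; rewrite H2reprK; exact: (svalP c). Qed.

(* Defined from a chosen extension and section; rho_cls shows that any others
   can be used. *)
Definition rho (c : H2ker) : H1 (H1Q e a) :=
  H1cls (rho_cocycle (svalP (cid (rho_section c)))).

Lemma rho_cls (E : mext a)
    (hE : H2pull (inc e) (H2cls E) = H2cls (mext_split (resN e a)))
    (s : {multiplicative N -> mtot E})
    (sp : forall n, mprj E (s n) = inc e n) :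
  rho (exist _ (H2cls E) hE) = H1cls (rho_cocycle sp).
Proof. by apply/rho_cocycle_equiv/H2clsP; rewrite H2reprK. Qed.

End Rho.

Arguments rho {N G Q} e {M} a c.

Record gext_mor (N' G' Q' N G Q : groupType)
    (e' : gext N' G' Q') (e : gext N G Q) := GExtMor {
  morN : {multiplicative N' -> N};
  morG : {multiplicative G' -> G};
  morQ : {multiplicative Q' -> Q};
  mor_inc : forall n, morG (inc e' n) = inc e (morN n);
  mor_prj : forall g, prj e (morG g) = morQ (prj e' g)
}.

Section Naturality.
Variables (N' G' Q' N G Q : groupType).
Variables (e' : gext N' G' Q') (e : gext N G Q) (f : gext_mor e' e).
Variables (M : zmodType) (a : gmod G M).

Let a' := gmod_pull (morG f) a.

Lemma kconj_mor n g : kconj e (morN f n) (morG f g) = morN f (kconj e' n g).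
Proof.
by apply: (inc_inj e); rewrite inc_kconj -!mor_inc inc_kconj mmorphJ.
Qed.

Definition res_mor : gmod_hom (gmod_pull (morN f) (resN e a)) (resN e' a').
Proof. by exists (fun m => m) => //= n m; rewrite mor_inc. Defined.

(* The inclusion of M^N in M^N', as a map of Q'-modules. *)
Definition fixed_mor :
  gmod_hom (gmod_pull (morQ f) (fixedQ e a)) (fixedQ e' a').
Proof.
exists (fixed_map res_mor) => [m m'|q m]; first exact/val_inj.
have [g <-] := prj_surj e' q.
by rewrite fixedQE /= -mor_prj -[X in fixed_map _ X]/(fixedQ e a _ m) fixedQE;
  apply/val_inj.
Defined.

(* The map [d] |-> [d \o morN f] from H^1(N, M) to H^1(N', M), as a map of
   Q'-modules. *)
Definition H1_mor : gmod_hom (gmod_pull (morQ f) (H1Q e a)) (H1Q e' a').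
Proof.
exists (H1map res_mor) => [|q c]; first exact: H1mapD.
have [g <-] := prj_surj e' q; rewrite -[c]H1reprK; set d := H1repr c.
rewrite -[gmod_pull _ _ _ _]/(H1Q e a (morQ f _) _) -mor_prj.
rewrite H1QE !H1map_cls H1QE; congr H1cls; apply: derP => n /=.
by rewrite kconj_mor.
Defined.

Lemma H2ker_mor_subproof (c : H2ker e a) :
  H2pull (inc e') (H2pull (morG f) (sval c))
  = H2cls (mext_split (resN e' a')).
Proof.
have [s sp] := rho_section c.
rewrite -[sval c]H2reprK H2pull_cls; apply/H2pull_splitP.
have h n : mprj (H2repr (sval c)) (s (morN f n)) = morG f (inc e' n).
  by rewrite sp mor_inc.
have psiM : {morph (fun n => mkfib (h n)) : x y / x * y}.
  by move=> x y; apply/val_inj; congr (_, _); rewrite /= !gmulfM.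
by exists (mkmult psiM : {multiplicative N' -> mtot (mext_pull _ _)}).
Qed.

Definition H2ker_mor (c : H2ker e a) : H2ker e' a' :=
  exist _ (H2pull (morG f) (sval c)) (H2ker_mor_subproof c).

End Naturality.

(* Main.v *)
Require Import Defs.
From HB Require Import structures.
From mathcomp Require Import all_boot ssralg ring_quotient boolp functions.

Set Implicit Arguments.
Unset Strict Implicit.
Unset Printing Implicit Defensive.

Import GRing.Theory.

Local Open Scope ring_scope.
Local Open Scope group_scope.

(** Both equalities are checked on representatives, with morphisms of group
extensions.

(i) Put [d' n := d (morN f n)].  The homomorphism [(m, g) |-> (m, morG f g)]
from the semidirect product of [M] and [G'] to that of [M] and [G] ([sd_mor])
need not send the normalizer of the graph of [d'] into that of the graph of [d];
but conversely a pair [(m, g)] normalizes the graph of [d'] as soon as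
[(m, morG f g)] normalizes the graph of [d] ([normalizer_mor]).  Given a coset
in the extension [tr_ext] of [d] and an element [q] of [Q'] with the same image
in [Q], one can choose in this coset a representative of the form
[(m, morG f g)] with [g] above [q] ([tr_rel_total]), and send the pair to the
coset of [(m, g)].  Two choices differ by an element of the graph of [d']
([tr_rel_fun]), so this is a homomorphism from the pullback along [morQ f] of
the extension of [d] to the extension of [d'].  It lies over the identity of
[Q'] and restricts to the inclusion of [M^N] in [M^N'], and such a homomorphism
identifies its target with the pushout of its source ([mext_push_univ]).

(ii) A section [s] over [N] of an extension [E] of [G] induces the section
[n |-> (s (morN f n), inc e' n)] over [N'] of the pullback of [E].  With this
choice the two cocycles are equal ([rho_cocycle_mor]): for an element [x] of the
pullback, with component [y] in [E], the derivation [d_x] is the composite of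
[d_y] with [morN f]. *)

(** * Homomorphisms from relations and from pushouts *)

(** Used to define a homomorphism through a choice that does not affect the
value: multiplicativity then only has to be checked on the relation. *)
Lemma group_rel_morphism (G H : groupType) (R : G -> H -> Prop) :
    (forall x, exists y, R x y) ->
    (forall x y y', R x y -> R x y' -> y = y') ->
    (forall x x' y y', R x y -> R x' y' -> R (x * x') (y * y')) ->
  exists f : {multiplicative G -> H}, forall x, R x (f x).
Proof.
move=> Rtot Rfun RM.
pose f x := sval (cid (Rtot x)).
have fP x : R x (f x) := svalP (cid (Rtot x)).
have fM : {morph f : x y / x * y}.
  by move=> x y; apply: Rfun (fP _) _; apply: RM.
by exists (mkmult fM).
Qed.

(** The universal property of the pushout turns [psi] into a morphism of
extensions of [G] by [M'], and every such morphism is an equivalence. *)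
Lemma mext_push_univ (G : groupType) (M M' : zmodType)
    (a : gmod G M) (a' : gmod G M') (phi : gmod_hom a a')
    (E : mext a) (E' : mext a') (psi : {multiplicative mtot E -> mtot E'}) :
    (forall m, psi (minj E m) = minj E' (phi m)) ->
    (forall x, mprj E' (psi x) = mprj E x) ->
  mequiv (mext_push phi E) E'.
Proof.
move=> psii psip.
pose T : groupType := sdprod (gmod_pull (mprj E) a').
have hM : {morph (fun x : T => minj E' x.1 * psi x.2) : x y / x * y}.
  move=> x y; rewrite /= gmulfM minjD -!mulgA; congr (_ * _).
  by rewrite !mulgA minjC psip.
have hK x : push_rel phi E x -> mkmult hM x = 1.
  by move=> [m ->]; rewrite /= psii minjN mulVg.
exists (gquot_lift hK : {multiplicative mtot (mext_push phi E) -> _}).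
split=> [m|x].
  by apply: (etrans (gquot_liftE hK _)); rewrite /= mmorph1 mulg1.
rewrite -[x]greprK [X in mprj _ X](gquot_liftE hK) [RHS]push_prjE /=.
by rewrite gmulfM mprj_inj mul1g psip.
Qed.

Section Naturality.
Variables (N' G' Q' N G Q : groupType).
Variables (e' : gext N' G' Q') (e : gext N G Q) (f : gext_mor e' e).
Variables (M : zmodType) (a : gmod G M).

Let a' := gmod_pull (morG f) a.

(** * The transgression *)

Section Tr.
Variable d : der (resN e a).

Let d' : der (resN e' a') := der_map (res_mor f a) d.

Definition sd_mor (y : sdprod a') : sdprod a := (y.1, morG f y.2).

Lemma sd_morM : {morph sd_mor : x y / x * y}.
Proof. by move=> x y; rewrite /sd_mor !sdM /= gmulfM. Qed.

Lemma sd_morV y : sd_mor y^-1 = (sd_mor y)^-1.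
Proof. exact: (mmorphV (mkmult sd_morM)). Qed.

(** The component in [G'] has to be assumed in [N'], since [morG f] may also send
other elements of [G'] into [N]. *)
Lemma graph_mor (y : sdprod a') n :
  y.2 = inc e' n -> graph d (sd_mor y) -> graph d' y.
Proof.
case: y => m g /= -> [k [-> ]]; rewrite mor_inc => /(inc_inj e) <-.
by exists n.
Qed.

(** By [graph_normP], normalizing the graph is one equation for each element of
the kernel; the equation of [y] at [n] is that of [sd_mor y] at [morN f n]. *)
Lemma normalizer_mor (y : sdprod a') (x : normalizer (graph d)) :
  normalizer_val x = sd_mor y ->
  forall z, graph d' (z ^ y) <-> graph d' z.
Proof.
case: y => m g xE; apply/graph_normP => n.
have := normalizerP x; rewrite xE => /graph_normP/(_ (morN f n)).
by rewrite kconj_mor /= mor_inc.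
Qed.

Lemma graph_normalizes n (y : sdprod a) :
  graph d (y ^ ((d n, inc e n) : sdprod a)) <-> graph d y.
Proof.
move: y; apply/graph_normP => k; rewrite kconj_inc conjgE.
have := derM d n (n^-1 * (k * n)); rewrite mulVKg derM /= => E.
apply/eqP; rewrite subr_eq addrAC eq_sym subr_eq addrC [X in _ == X]addrC.
by rewrite E.
Qed.

Variables (d_inv : forall q, H1Q e a q (H1cls d) = H1cls d)
  (d'_inv : forall q, H1Q e' a' q (H1cls d') = H1cls d').

Let E := tr_ext d_inv.
Let E' := tr_ext d'_inv.

(** The graph of the homomorphism from the pullback of [E] to [E'], which sends
the class of [(m, morG f g)], paired with the image of [g] in [Q'], to the class
of [(m, g)]. *)
Definition tr_rel (u : fib (morQ f) E) (v : trgroup d') :=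
  exists (x : normalizer (graph d)) (y : normalizer (graph d')),
    [/\ normalizer_val x = sd_mor (normalizer_val y),
        (val u).1 = gcls (tr_sub d) x,
        (val u).2 = prj e' (normalizer_val y).2
      & v = gcls (tr_sub d') y].

(** A representative [x] of the coset and a lift [g] of [q] have the same image
in [Q], so their components in [G] differ by some [n] in [N]; multiplying [x] by
the element [(d n, n)] of the graph makes them agree. *)
Lemma tr_rel_total u : exists v, tr_rel u v.
Proof.
have := fibP u; set c := (val u).1; set q := (val u).2.
rewrite -[c]greprK [X in X = _]tr_prjE; set x := grepr c => xq.
have [g gq] := prj_surj e' q.
have [n gE] : exists n, morG f g = (normalizer_val x).2 * inc e n.
  by apply: (@prj_eq _ _ _ e); rewrite mor_prj gq xq.
set h := mknormalizer (graph_normalizes n).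
pose w : sdprod a' := ((normalizer_val x * normalizer_val h).1, g).
have xhE : normalizer_val (x * h) = sd_mor w.
  by rewrite /sd_mor /= gE.
exists (gcls (tr_sub d') (mknormalizer (normalizer_mor xhE))).
exists (x * h), (mknormalizer (normalizer_mor xhE)); split=> //.
rewrite -[LHS]greprK; apply/gclsP; rewrite mulKg; exact: (ex_intro _ n).
Qed.

(** Two pairs related to the same element have quotient over some [n] in [N'],
and its image under [sd_mor] lies in the graph of [d]. *)
Lemma tr_rel_fun u v v' : tr_rel u v -> tr_rel u v' -> v = v'.
Proof.
move=> [x [y [xE ux uy ->]]] [x1 [y1 [xE1 ux1 uy1 ->]]].
have /prj_eq[n gE] : prj e' (normalizer_val y).2 = prj e' (normalizer_val y1).2.
  by rewrite -uy.
apply/gclsP; change (graph d' (normalizer_val (y^-1 * y1))).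
rewrite normalizer_valM normalizer_valV.
apply: (@graph_mor _ n); first by rewrite sdM sdV /= gE mulKg.
rewrite sd_morM sd_morV -xE -xE1 -normalizer_valV -normalizer_valM.
by apply/(@gclsP _ (tr_sub d)); rewrite -ux.
Qed.

Lemma tr_relM u u1 v v1 : tr_rel u v -> tr_rel u1 v1 -> tr_rel (u * u1) (v * v1).
Proof.
move=> [x [y [xE ux uy ->]]] [x1 [y1 [xE1 ux1 uy1 ->]]].
exists (x * x1), (y * y1); split; last by rewrite gclsM.
- by rewrite !normalizer_valM xE xE1 sd_morM.
- by rewrite gclsM -ux -ux1.
- by rewrite normalizer_valM sdM /= gmulfM -uy -uy1.
Qed.

Lemma tr_ext_mor :
  mequiv (mext_push (fixed_mor f a) (mext_pull (morQ f) E)) E'.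
Proof.
have [psi psiP] := group_rel_morphism tr_rel_total tr_rel_fun tr_relM.
apply: (@mext_push_univ _ _ _ _ _ _ (mext_pull _ E) E' psi) => [m|u].
  apply: tr_rel_fun (psiP _) _.
  exists (mknormalizer (tr_inj_subproof d m)).
  exists (mknormalizer (tr_inj_subproof d' (fixed_mor f a m))).
  by split=> //=; rewrite /sd_mor /= mmorph1.
have [x [y [_ _ uy ->]]] := psiP u.
by apply: (etrans (tr_prjE _)); rewrite -uy.
Qed.

End Tr.

Lemma tr_mor (c : fixed (H1Q e a)) :
  tr e' a' (fixed_map (H1_mor f a) c)
  = H2push (fixed_mor f a) (H2pull (morQ f) (tr e a c)).
Proof.
pose d := H1repr (val c); pose d' := der_map (res_mor f a) d.
have d'_inv q : H1Q e' a' q (H1cls d') = H1cls d'.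
  rewrite -H1map_cls H1reprK; exact: (fixedP (fixed_map (H1_mor f a) c)).
have -> : fixed_map (H1_mor f a) c = mkfixed d'_inv by exact/val_inj.
rewrite tr_cls /tr H2pull_cls H2push_cls; apply/esym/H2clsP.
exact: tr_ext_mor.
Qed.

(** * The map rho *)

Section Rho.
Variables (E : mext a) (s : {multiplicative N -> mtot E}).
Hypothesis sp : forall n, mprj E (s n) = inc e n.

Lemma pull_section : exists s' : {multiplicative N' -> fib (morG f) E},
  forall n, val (s' n) = (s (morN f n), inc e' n).
Proof.
have h n : mprj E (s (morN f n)) = morG f (inc e' n) by rewrite sp mor_inc.
have sM : {morph (fun n => mkfib (h n)) : x y / x * y}.
  by move=> x y; apply/val_inj; congr (_, _); rewrite /= !gmulfM.
by exists (mkmult sM).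
Qed.

Lemma rho_cocycle_mor (s' : {multiplicative N' -> fib (morG f) E})
    (sp' : forall n, mprj (mext_pull (morG f) E) (s' n) = inc e' n) :
    (forall n, val (s' n) = (s (morN f n), inc e' n)) ->
  rho_cocycle sp' = der_map (H1_mor f a) (rho_cocycle sp).
Proof.
move=> s'E; apply: derP => q.
have [x <-] := prj_mprj_surj e' (mext_pull (morG f) E) q.
rewrite rho_cocycleE /= -mor_prj -[morG f _](fibP x).
rewrite -[rho_cocycle_fun sp _]/(rho_cocycle sp _) rho_cocycleE H1map_cls.
congr H1cls; apply: derP => n /=; apply: (minj_inj E).
have /(congr1 (fun z : fib (morG f) E => (val z).1)) /= -> := rho_funE sp' x n.
have s'1 k : (fib_val (s' k)).1 = s (morN f k) := congr1 fst (s'E k).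
by rewrite rho_funE [mprj E _](fibP x) kconj_mor !s'1.
Qed.

End Rho.

Lemma rho_mor (c : H2ker e a) :
  rho e' a' (H2ker_mor f c) = H1map (H1_mor f a) (rho e a c).
Proof.
have [s' s'E] := pull_section (svalP (cid (rho_section c))).
have sp' n : mprj (mext_pull (morG f) _) (s' n) = inc e' n.
  exact: (congr1 snd (s'E n)).
rewrite [rho e a c]/rho H1map_cls -(rho_cocycle_mor _ sp' s'E).
exact: (@rho_cls _ _ _ e' _ a' _ (H2ker_mor_subproof f c) s' sp').
Qed.

End Naturality.

Theorem mainTheorem2 (N' G' Q' N G Q : groupType)
    (e' : gext N' G' Q') (e : gext N G Q) (f : gext_mor e' e)
    (M : zmodType) (a : gmod G M) :
  (forall c : fixed (H1Q e a),
     tr e' (gmod_pull (morG f) a) (fixed_map (H1_mor f a) c)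
     = H2push (fixed_mor f a) (H2pull (morQ f) (tr e a c)))
  /\
  (forall c : H2ker e a,
     rho e' (gmod_pull (morG f) a) (H2ker_mor f c)
     = H1map (H1_mor f a) (rho e a c)).
Proof. by split=> c; [apply: tr_mor | apply: rho_mor]. Qed.
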